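(* Let $n\ge 1$ and let $(\mathcal{A},\partial_{\mathcal{A}})$ be a connected cochain DG algebra over $\Bbbk$ whose underlying graded algebra $\mathcal{A}^{\#}$ is the polynomial graded algebra $\Bbbk[x_1,x_2,\cdots,x_n]$ with $|x_i|=1$ for every $i\in\{1,2,\cdots,n\}$. Then there exist $t_1,t_2,\cdots,t_n\in\Bbbk$ such that $\partial_{\mathcal{A}}$ is defined by $$\partial_{\mathcal{A}}(x_i)=\sum_{j=1}^n t_jx_ix_j=\sum_{j=1}^{i-1}t_jx_jx_i+t_ix_i^2+\sum_{j=i+1}^n t_jx_ix_j\quad\text{for all } i\in\{1,2,\cdots,n\}.$$ Conversely, for any point $(t_1,t_2,\cdots,t_n)$ in the affine $n$-space $\mathbb{A}_{\Bbbk}^n$, one can define a differential $\partial$ on $\Bbbk[x_1,x_2,\cdots,x_n]$ by $$\partial(x_i)=\sum_{j=1}^{i-1}t_jx_jx_i+t_ix_i^2+\sum_{j=i+1}^n t_jx_ix_j\quad\text{for all } i\in\{1,2,\cdots,n\},$$ such that $(\Bbbk[x_1,x_2,\cdots,x_n],\partial)$ is a DG polynomial algebra.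
   Context: $\Bbbk$ is an algebraically closed field of characteristic $0$. A cochain DG algebra is a graded $\Bbbk$-algebra $\mathcal{A}$ with a $\Bbbk$-linear differential $\partial_{\mathcal{A}}:\mathcal{A}\to\mathcal{A}$ of degree $1$, $\partial_{\mathcal{A}}^2=0$, satisfying the Leibniz rule $\partial_{\mathcal{A}}(ab)=(\partial_{\mathcal{A}}a)b+(-1)^{|a|}a(\partial_{\mathcal{A}}b)$ for all homogeneous $a,b$. Its underlying graded algebra is denoted $\mathcal{A}^{\#}$; $\mathcal{A}$ is connected if $\mathcal{A}^{\#}$ is a connected graded algebra ($\mathcal{A}^0=\Bbbk$ and $\mathcal{A}^i=0$ for $i<0$). The polynomial algebra $\Bbbk[x_1,\dots,x_n]$ is the ordinary commutative one ($x_ix_j=x_jx_i$ with no sign), graded by $|x_i|=1$. A DG polynomial algebra is a connected cochain DG algebra whose underlying graded algebra is a polynomial algebra $\Bbbk[x_1,\dots,x_n]$ with $|x_i|=1$ for all $i$. *)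

(* Defs.v *)
From HB Require Import structures.
From mathcomp Require Import all_boot all_order all_algebra.
From mathcomp Require Export mpoly.

Set Implicit Arguments.
Unset Strict Implicit.
Unset Printing Implicit Defensive.

Import GRing.Theory.
Local Open Scope ring_scope.

(* gr i is the homogeneous component A^i, i : int. *)
Record graded_algebra (K : fieldType) (A : algType K) (gr : int -> {pred A})
    : Prop := GradedAlgebra {
  graded_submod : forall i, submod_closed (gr i);
  graded_span : forall a : A, exists (s : seq int) (c : int -> A),
    (forall i, c i \in gr i) /\ a = \sum_(i <- s) c i;
  graded_free : forall (s : seq int) (c : int -> A),
    uniq s -> (forall i, c i \in gr i) -> \sum_(i <- s) c i = 0 ->
    forall i, i \in s -> c i = 0;
  graded_one : 1 \in gr 0;
  graded_mul : forall (i j : int) (a b : A),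
    a \in gr i -> b \in gr j -> a * b \in gr (i + j)
}.

(* An algType is nontrivial (1 != 0), so the second field makes A^0 a copy
   of K. *)
Record connected_graded (K : fieldType) (A : algType K) (gr : int -> {pred A})
    : Prop := ConnectedGraded {
  connected_neg : forall (i : int) (a : A), i < 0 -> a \in gr i -> a = 0;
  connected_zero : forall a : A, a \in gr 0 -> exists c : K, a = c%:A
}.

Record cochain_DG_algebra (K : fieldType) (A : algType K)
    (gr : int -> {pred A}) (d : A -> A) : Prop := CochainDGAlgebra {
  DG_graded : graded_algebra gr;
  DG_linear : linear d;
  DG_degree : forall (i : int) (a : A), a \in gr i -> d a \in gr (i + 1);
  DG_square : forall a : A, d (d a) = 0;
  (* (-1) ^ i is the integer power in K. *)
  DG_Leibniz : forall (i j : int) (a b : A), a \in gr i -> b \in gr j ->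
    d (a * b) = d a * b + (-1 : K) ^ i *: (a * d b)
}.

Definition connected_cochain_DG_algebra (K : fieldType) (A : algType K)
    (gr : int -> {pred A}) (d : A -> A) : Prop :=
  cochain_DG_algebra gr d /\ connected_graded gr.

(* The standard grading of K[x_1, ..., x_n], with |x_i| = 1; the library's
   .-homog is indexed by nat and contains 0 in every degree. *)
Definition mpoly_grading (K : fieldType) (n : nat) (i : int)
    : {pred {mpoly K[n]}} :=
  match i with
  | Posz m => [pred p | p \is m.-homog]
  | Negz _ => [pred p | p == 0]
  end.

Definition DG_polynomial_algebra (K : fieldType) (n : nat)
    (d : {mpoly K[n]} -> {mpoly K[n]}) : Prop :=
  connected_cochain_DG_algebra (@mpoly_grading K n) d.

(* Main.v *)
Require Import Defs.
From HB Require Import structures.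
From mathcomp Require Import all_boot all_order all_algebra.
From mathcomp Require Import mpoly.

Import GRing.Theory.
Local Open Scope ring_scope.

(* Since x_i and x_j commute and both have odd degree, the two Leibniz
   expansions of d(x_i x_j) give x_j d(x_i) = x_i d(x_j); comparing coefficients
   of these quadrics forces d(x_i) = x_i l for one linear form l = sum t_j x_j.
   Conversely, given l, the map sending a homogeneous p to l p in odd degree
   and to 0 in even degree is a differential with d(x_i) = x_i l. *)

Section Grading.
Context {K : fieldType} {n : nat}.
Local Notation P := {mpoly K[n]}.

Lemma mpoly_grading_coeff {i} {p : P} {m : 'X_{1..n}} :
  p \in @mpoly_grading K n i -> Posz (mdeg m) != i -> p@_m = 0.
Proof.
case: i => k /=; rewrite inE; first exact: dhomog_nemf_coeff.
by move/eqP=> ->; rewrite mcoeff0.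
Qed.

Lemma mpoly_grading0 i : (0 : P) \in @mpoly_grading K n i.
Proof. by case: i => k; rewrite inE ?dhomog0 /=. Qed.

Lemma mpoly_graded_algebra : graded_algebra (@mpoly_grading K n).
Proof.
split.
- case=> k; last first.
    by split=> [|a p q]; rewrite !inE // => /eqP-> /eqP->; rewrite scaler0 addr0.
  exact: dhomog_submod_closed.
(* The components of [p] are its projections [pihomog mdeg k p]; those of degree at least [msize p]
   vanish, so a finite range of degrees suffices. *)
- move=> p; pose c (i : int) := if i is Posz k then pihomog mdeg k p else 0 : P.
  exists (map Posz (iota 0 (msize p))), c; split.
    by case=> k; rewrite inE //=; exact: pihomogP.
  rewrite [LHS](@pihomog_partitionE _ _ mdeg _ p (leqnn _)) big_map /=.
  by rewrite -(big_mkord xpredT (fun k => pihomog mdeg k p)) /index_iota subn0.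
(* Independence is read off coefficientwise: the monomial [m] can occur only in the component of
   degree [mdeg m]. *)
- move=> s c uniq_s grc sum0 i s_i; apply/mpolyP => m; rewrite mcoeff0.
  have [deg_m|] := eqVneq (Posz (mdeg m)) i; last exact: mpoly_grading_coeff.
  have := congr1 (mcoeff m) sum0.
  rewrite (bigD1_seq i) //= mcoeffD mcoeff0 raddf_sum big1 ?addr0 //= => j ji.
  by apply: (mpoly_grading_coeff (grc j)); rewrite deg_m eq_sym.
- exact: dhomog1.
- move=> i j a b; case: i => [k|k].
    case: j => [l|l]; first exact: dhomogM.
    by move=> _ /eqP->; rewrite mulr0; exact (mpoly_grading0 _).
  by move=> /eqP-> _; rewrite mul0r; exact (mpoly_grading0 _).
Qed.

Lemma mpoly_connected_graded : connected_graded (@mpoly_grading K n).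
Proof.
split=> [[] // k p _ /eqP //|p hom_p].
(* The scalar is the constant coefficient, [0] being the only monomial of degree 0. *)
exists p@_0; apply/mpolyP => m; rewrite mcoeffZ mcoeff1.
have [->|m0] := eqVneq m 0%MM; first by rewrite mulr1.
by rewrite mulr0 (mpoly_grading_coeff hom_p) // eqz_nat mdeg_eq0.
Qed.

End Grading.

(** Every monomial in the support of a multiple of ['X_i] has positive exponent at [i]. *)
Lemma mcoeffMX_eq0 {R : nzRingType} {n : nat} (p : {mpoly R[n]}) {i : 'I_n}
    {m : 'X_{1..n}} : m i = 0%N -> (p * 'X_i)@_m = 0.
Proof.
move=> mi0; apply: memN_msupp_eq0; apply/negP.
move=> /msuppM_le/allpairsP[[m1 m2] [/= _]]; rewrite msuppX inE => /eqP->.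
by move/mnmP/(_ i); rewrite mi0 mnmDE mnm1E eqxx addn1.
Qed.

Section Necessity.
Context {K : fieldType} {n : nat}.
Hypothesis two_neq0 : 2 != 0 :> K.
Context {d : {mpoly K[n]} -> {mpoly K[n]}} (DGd : DG_polynomial_algebra d).

Lemma homog_diffX (i : 'I_n) : d 'X_i \is 2.-homog.
Proof.
by have := @DG_degree _ _ _ _ DGd.1 1 'X_i; rewrite !inE /= dhomogX /= mdeg1; apply.
Qed.

Lemma mulX_diffX (i j : 'I_n) : d 'X_i * 'X_j = d 'X_j * 'X_i.
Proof.
have Leibniz (k l : 'I_n) : d ('X_k * 'X_l) = d 'X_k * 'X_l - 'X_k * d 'X_l.
  have homX h : ('X_h : {mpoly K[n]}) \in @mpoly_grading K n 1.
    by rewrite inE /= dhomogX /= mdeg1.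
  by rewrite (DG_Leibniz DGd.1 (homX k) (homX l)) expr1z scaleN1r.
(* Expanding both orders of the product shows that twice the difference of the two sides vanishes;
   this is where 2 must be invertible. *)
have := Leibniz i j; rewrite [in LHS]mulrC Leibniz => /eqP.
rewrite ['X_j * _]mulrC ['X_i * d _]mulrC -[X in _ == X]opprB -addr_eq0.
by rewrite -mulr2n -scaler_nat scaler_eq0 (negPf two_neq0) subr_eq0 => /eqP.
Qed.

(** Both sides are the coefficient of [m + U_(i) + U_(j)] in [mulX_diffX]. Hence the quotients of
    the [d 'X_i] by ['X_i] will all be the same linear form. *)
Lemma mcoeff_diffX (i j : 'I_n) (m : 'X_{1..n}) :
  (d 'X_i)@_(m + U_(i)) = (d 'X_j)@_(m + U_(j)).
Proof.
rewrite -[LHS](mcoeffMX _ U_(j)) -[RHS](mcoeffMX _ U_(i)) mulX_diffX.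
by rewrite addmA [in RHS]addmC [(m + U_(j))%MM]addmC.
Qed.

(** This is the divisibility of [d 'X_i] by ['X_i]. For [j] different from [i], the product
    [d 'X_i * 'X_j] is a multiple of ['X_i], and multiplying by ['X_j] leaves the exponent at [i]
    unchanged. *)
Lemma mcoeff_diffX_eq0 (i : 'I_n) (m : 'X_{1..n}) : m i = 0%N -> (d 'X_i)@_m = 0.
Proof.
move=> mi0.
have [deg_m|] := eqVneq (mdeg m) 2; last exact/dhomog_nemf_coeff/homog_diffX.
(* An index other than [i] is needed; one is found in the support of [m], which is nonempty because
   [m] has degree 2. *)
have [j mj0] : exists j, m j != 0%N.
  apply/existsP; rewrite -negb_forall; apply: contraPN deg_m => /forallP m0.
  by rewrite mdegE big1 // => j _; apply/eqP.
have i_j : (i == j) = false by apply: contraNF mj0 => /eqP <-; rewrite mi0.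
rewrite -(mcoeffMX _ U_(j)) mulX_diffX.
by apply: mcoeffMX_eq0; rewrite mnmDE mnm1E mi0 eq_sym i_j.
Qed.

(** The scalar [t_j] is the coefficient of ['X_j ^+ 2] in [d 'X_j]. By [mcoeff_diffX] it is also the
    coefficient of ['X_i * 'X_j] in [d 'X_i] for every [i]. *)
Lemma diffX_linear_form (i : 'I_n) :
  d 'X_i = \sum_(j < n) (d 'X_j)@_(U_(j) + U_(j)) *: ('X_i * 'X_j).
Proof.
pose l := \sum_(j < n) (d 'X_j)@_(U_(j) + U_(j)) *: 'X_j : {mpoly K[n]}.
have -> : \sum_(j < n) (d 'X_j)@_(U_(j) + U_(j)) *: ('X_i * 'X_j) = l * 'X_i.
  by rewrite mulr_suml; apply: eq_bigr => j _; rewrite -scalerAl mulrC.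
apply/mpolyP => m; have [mi0|mi0] := eqVneq (m i) 0%N.
  by rewrite mcoeff_diffX_eq0 // mcoeffMX_eq0.
(* As ['X_i] divides both sides, it remains to compare coefficients after dividing by ['X_i]. *)
rewrite -(@submK _ U_(i) m) ?lep1mP // [in RHS]addmC mcoeffMX /l raddf_sum /=.
move: (m - U_(i))%MM => {mi0}m; have [|deg_m] := eqVneq (mdeg m) 1%N.
  move/eqP/mdeg1P=> [k /eqP->]; rewrite (mcoeff_diffX i k) (bigD1 k) //=.
  rewrite mcoeffZ mcoeffXU eqxx mulr1 big1 ?addr0 // => j /negPf jk.
  by rewrite mcoeffZ mcoeffXU jk mulr0.
rewrite (dhomog_nemf_coeff (homog_diffX i)); last by rewrite /= mdegD mdeg1 addn1.
rewrite big1 // => j _; rewrite mcoeffZ mcoeffX.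
have [Ujm|_] := eqVneq U_(j)%MM m; last by rewrite mulr0.
by rewrite -Ujm mdeg1 in deg_m.
Qed.

End Necessity.

Section Sufficiency.
Context {K : fieldType} {n : nat}.
Hypothesis two_neq0 : 2 != 0 :> K.
Local Notation P := {mpoly K[n]}.

(** The projection onto the components of odd degree, written as (p(x) - p(-x)) / 2 so that
    linearity is immediate. *)
Definition odd_part (p : P) : P :=
  2^-1 *: (p - (p \mPo [tuple - 'X_i | i < n])).

Lemma odd_part_is_linear : linear odd_part.
Proof.
move=> a p q; rewrite /odd_part comp_mpolyD comp_mpolyZ.
by rewrite opprD addrACA -scalerBr scalerDr !scalerA mulrC.
Qed.

HB.instance Definition _ := GRing.isLinear.Build K P P _ odd_part odd_part_is_linear.

Lemma odd_part_homog {k} {p : P} :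
  p \is k.-homog -> odd_part p = if odd k then p else 0.
Proof.
move=> /dhomogP hom_p.
have -> : odd_part p = 2^-1 *: (p - (-1) ^+ k *: p).
  (* Substituting [- 'X_i] for each ['X_i] multiplies a monomial of degree [k] by [(-1) ^+ k]. *)
  congr (_ *: (_ - _)); rewrite comp_mpolyEX [in RHS](mpolyE p) scaler_sumr.
  rewrite !big_seq; apply: eq_bigr => m /hom_p <-.
  rewrite scalerA mulrC -scalerA; congr (_ *: _).
  rewrite /= comp_mpolyX mdegE -prodrXr [in RHS]mpolyXE_id -scaler_prod.
  by apply: eq_bigr => i _; rewrite tnth_mktuple -scaleN1r exprZn.
rewrite -signr_odd; case: (odd k); last by rewrite scale1r subrr scaler0.
by rewrite expr1 scaleN1r opprK -mulr2n -scaler_nat scalerA mulVf // scale1r.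
Qed.

Context {l : P} (hom_l : l \is 1.-homog).

Lemma mul_odd_part_DG : DG_polynomial_algebra (fun p : P => l * odd_part p).
Proof.
have homE k (p : P) : p \is k.-homog -> l * odd_part p = if odd k then l * p else 0.
  by move=> /odd_part_homog->; case: odd; rewrite ?mulr0.
have hom_d k (p : P) : p \is k.-homog -> l * odd_part p \is k.+1.-homog.
  by move=> hp; rewrite (homE _ _ hp); case: odd; rewrite ?dhomog0 ?(dhomogM hom_l).
split; last exact: mpoly_connected_graded.
split; first exact: mpoly_graded_algebra.
- by move=> a p q; rewrite linearP mulrDr scalerAr.
- case=> k p; rewrite !inE /=.
    by rewrite addn1; exact: hom_d.
  by move=> /eqP->; rewrite raddf0 mulr0; exact: mpoly_grading0.
(* On each homogeneous component one of two consecutive degrees is even, so one of the two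
   applications gives 0. *)
- move=> p; rewrite (@pihomog_partitionE _ _ mdeg _ p (leqnn _)).
  rewrite !raddf_sum mulr_sumr raddf_sum mulr_sumr big1 //= => k _.
  have hk := pihomogP mdeg k p; rewrite (homE _ _ (hom_d _ _ hk)) (homE _ _ hk) /=.
  by case: odd; rewrite ?mulr0.
(* In nonnegative degrees there are four parity cases. For two odd factors the product is even and
   the terms [l * a * b] and [a * (l * b)] cancel; for mixed parities exactly one term survives,
   with sign +1; for two even factors all terms vanish. *)
- case=> k [] j a b; rewrite !inE /=.
  + move=> ha hb; rewrite (homE _ _ ha) (homE _ _ hb) (homE _ _ (dhomogM ha hb)).
    rewrite -exprnP -signr_odd oddD.
    case: (odd k) (odd j) => [] [] /=; rewrite ?(mul0r, mulr0, scaler0, addr0, add0r).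
    * by rewrite expr1 scaleN1r mulrCA mulrA subrr.
    * by rewrite mulrA.
    * by rewrite expr0 scale1r mulrCA.
    * by [].
  + by move=> _ /eqP->; rewrite !(raddf0, mulr0) ?scaler0 ?addr0.
  + by move=> /eqP-> _; rewrite !(raddf0, mulr0, mul0r) ?scaler0 ?addr0.
  + by move=> /eqP-> _; rewrite !(raddf0, mulr0, mul0r) ?scaler0 ?addr0.
Qed.

End Sufficiency.

Lemma big_ord_split3 {V : nmodType} {n : nat} (F : 'I_n -> V) (i : 'I_n) :
  \sum_(j < n) F j =
  \sum_(j < n | (j < i)%N) F j + F i + \sum_(j < n | (i < j)%N) F j.
Proof.
rewrite (bigID (fun j : 'I_n => (j < i)%N)) /= -addrA; congr (_ + _).
rewrite (bigD1 i) ?ltnn //=; congr (_ + _); apply: eq_bigl => j.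
by rewrite -leqNgt ltn_neqAle andbC eq_sym.
Qed.

Theorem theoremA (K : closedFieldType) (charK : [pchar K] =i pred0)
    (n : nat) (n_ge1 : (1 <= n)%N) :
  (forall d : {mpoly K[n]} -> {mpoly K[n]},
     DG_polynomial_algebra d ->
     exists t : 'I_n -> K, forall i : 'I_n,
       d 'X_i = \sum_(j < n) t j *: ('X_i * 'X_j) /\
       \sum_(j < n) t j *: ('X_i * 'X_j) =
         \sum_(j < n | (j < i)%N) t j *: ('X_j * 'X_i) + t i *: 'X_i ^+ 2
           + \sum_(j < n | (i < j)%N) t j *: ('X_i * 'X_j) :> {mpoly K[n]}) /\
  (forall t : 'I_n -> K,
     exists d : {mpoly K[n]} -> {mpoly K[n]},
       DG_polynomial_algebra d /\
       forall i : 'I_n,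
         d 'X_i =
           \sum_(j < n | (j < i)%N) t j *: ('X_j * 'X_i) + t i *: 'X_i ^+ 2
             + \sum_(j < n | (i < j)%N) t j *: ('X_i * 'X_j)).
Proof.
have two_neq0 : 2 != 0 :> K.
  by apply/negP => K2; have := charK 2; rewrite !inE K2.
have splitE (t : 'I_n -> K) (i : 'I_n) :
    \sum_(j < n) t j *: ('X_i * 'X_j) =
      \sum_(j < n | (j < i)%N) t j *: ('X_j * 'X_i) + t i *: 'X_i ^+ 2
        + \sum_(j < n | (i < j)%N) t j *: ('X_i * 'X_j) :> {mpoly K[n]}.
  rewrite (big_ord_split3 _ i) expr2; congr (_ + _ + _).
  by apply: eq_bigr => j _; rewrite mulrC.
split=> [d DGd | t].
  exists (fun j => (d 'X_j)@_(U_(j) + U_(j))) => i; split; last exact: splitE.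
  exact: diffX_linear_form.
pose l := \sum_(j < n) t j *: 'X_j : {mpoly K[n]}.
have hom_l : l \is 1.-homog.
  by apply: rpred_sum => j _; rewrite rpredZ // dhomogX /= mdeg1.
exists (fun p => l * odd_part p); split=> [|i]; first exact: mul_odd_part_DG.
rewrite -splitE (odd_part_homog two_neq0 (k := 1)) ?dhomogX /= ?mdeg1 //.
by rewrite mulr_suml; apply: eq_bigr => j _; rewrite -scalerAl mulrC.
Qed.
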